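(* Let $m,n\in\mathbb{Z}$ with $m\neq n$, let $a_0,a_1,a_2,b_0,b_1,b_2\in\mathbb{C}^{\times}$, and let $\tau_{10},\tau_{21},\tau_{02}$ be the corrected transition matrices $\tau_{ij}=\tau_{ij}^{sf}\Theta_{ij}$ on $\mathbb{P}^2$ defined in the context. If $\prod_{i=0}^{2}a_ib_i=-1$, then $$\tau_{02}\,\tau_{21}\,\tau_{10}=I.$$ Moreover, the $(\mathbb{C}^{\times})^2$-equivariant structures on the local rank $2$ bundles over $U_0,U_1,U_2$ given by the three formulas displayed in the context extend to a $(\mathbb{C}^{\times})^2$-equivariant structure on the rank $2$ bundle on $\mathbb{P}^2$ with transition functions $\tau_{ij}$ (i.e. they are compatible with the $\tau_{ij}$).
   Context: Let $[\zeta^0:\zeta^1:\zeta^2]$ be homogeneous coordinates on $\mathbb{P}^2$, $U_i=\{\zeta^i\neq 0\}$, $w_i^j:=\zeta^j/\zeta^i$. On each $U_i$ take a trivial rank $2$ bundle with ordered fibre coordinates $(v_0^+,v_0^-)$ on $U_0$, $(v_1^-,v_1^+)$ on $U_1$, $(v_2^+,v_2^-)$ on $U_2$. A matrix $\tau_{ij}$ maps the fibre coordinate column over $U_j$ to that over $U_i$. Local equivariant structures, for $(\lambda_1,\lambda_2)\in(\mathbb{C}^\times)^2$: $$(\lambda_1,\lambda_2)\cdot(w_0^1,w_0^2,v_0^+,v_0^-)=(\lambda_1w_0^1,\lambda_2w_0^2,\lambda_1^{m-n}v_0^+,\lambda_2^{m-n}v_0^-),$$ $$(\lambda_1,\lambda_2)\cdot(w_1^0,w_1^2,v_1^-,v_1^+)=(\lambda_1^{-1}w_1^0,\lambda_1^{-1}\lambda_2w_1^2,\lambda_1^{-n}v_1^-,\lambda_1^{-n}\lambda_2^{m-n}v_1^+),$$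 $$(\lambda_1,\lambda_2)\cdot(w_2^0,w_2^1,v_2^+,v_2^-)=(\lambda_2^{-1}w_2^0,\lambda_1\lambda_2^{-1}w_2^1,\lambda_2^{-n}v_2^+,\lambda_1^{m-n}\lambda_2^{-n}v_2^-).$$ Naive transition functions: $$\tau^{sf}_{10}=\begin{pmatrix}\frac{a_0}{(w_0^1)^m}&0\\0&\frac{b_0}{(w_0^1)^n}\end{pmatrix},\quad \tau^{sf}_{21}=\begin{pmatrix}\frac{b_1}{(w_1^2)^n}&0\\0&\frac{a_1}{(w_1^2)^m}\end{pmatrix},\quad \tau^{sf}_{02}=\begin{pmatrix}0&\frac{b_2}{(w_2^0)^n}\\\frac{a_2}{(w_2^0)^m}&0\end{pmatrix}.$$ Correction factors, for $m>n$: $$\Theta_{10}=I+\begin{pmatrix}0&0\\-a_0b_1a_2\left(\frac{w_0^2}{w_0^1}\right)^{m-n}&0\end{pmatrix},\quad \Theta_{21}=I+\begin{pmatrix}0&-a_0a_1b_2\left(\frac{w_1^0}{w_1^2}\right)^{m-n}\\0&0\end{pmatrix},\quad \Theta_{02}=I+\begin{pmatrix}0&0\\-b_0a_1a_2\left(\frac{w_2^1}{w_2^0}\right)^{m-n}&0\end{pmatrix};$$ for $m<n$: $$\Theta_{10}=I+\begin{pmatrix}0&-b_0a_1b_2\left(\frac{w_0^2}{w_0^1}\right)^{n-m}\\0&0\end{pmatrix},\quad \Theta_{21}=I+\begin{pmatrix}0&0\\-b_0b_1a_2\left(\frac{w_1^0}{w_1^2}\right)^{n-m}&0\end{pmatrix},\quad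 \Theta_{02}=I+\begin{pmatrix}0&-a_0b_1b_2\left(\frac{w_2^1}{w_2^0}\right)^{n-m}\\0&0\end{pmatrix}.$$ Put $\tau_{ij}:=\tau_{ij}^{sf}\Theta_{ij}$ on $U_i\cap U_j$, for $(i,j)=(1,0),(2,1),(0,2)$. *)

(* Defs.v *)
(* The complex numbers are R[i], for an arbitrary R : realType. *)
From HB Require Import structures.
From mathcomp Require Import all_boot all_order all_algebra.
From mathcomp Require Import boolp reals complex mpoly.

Set Implicit Arguments.
Unset Strict Implicit.
Unset Printing Implicit Defensive.
Import Order.TTheory GRing.Theory Num.Theory.
Local Open Scope ring_scope.
Local Open Scope quotient_scope.

Definition hcoord (R : realType) := {z : 'rV[R[i]]_3 | z != 0}.

Definition proportional (R : realType) : rel (hcoord R) :=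
  fun z z' => `[< exists2 c : R[i], c != 0 & val z' = c *: val z >].

Lemma proportional_refl (R : realType) : reflexive (@proportional R).
Proof. by move=> z; apply/asboolP; exists 1; rewrite ?oner_eq0 ?scale1r. Qed.

Lemma proportional_sym (R : realType) : ssrbool.symmetric (@proportional R).
Proof.
suff h (z z' : hcoord R) : proportional z z' -> proportional z' z.
  by move=> z z'; apply/idP/idP; apply: h.
move=> /asboolP[c c0 e]; apply/asboolP; exists c^-1; first by rewrite invr_eq0.
by rewrite e scalerA mulVf // scale1r.
Qed.

Lemma proportional_trans (R : realType) : transitive (@proportional R).
Proof.
move=> y x z /asboolP[c c0 e] /asboolP[d d0 e']; apply/asboolP.
by exists (d * c); rewrite ?mulf_neq0 // e' e scalerA.
Qed.

Canonical proportional_equiv (R : realType) :=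
  EquivRel (@proportional R) (@proportional_refl R) (@proportional_sym R)
    (@proportional_trans R).

Definition P2 (R : realType) := {eq_quot @proportional R}.

(* The point [z^0 : z^1 : z^2]. *)
Definition Ppoint (R : realType) (z : hcoord R) : P2 R := \pi_(P2 R) z.

Definition zeta (R : realType) (p : P2 R) (i : 'I_3) : R[i] :=
  val (repr p) ord0 i.

Lemma zeta_Ppoint (R : realType) (z : hcoord R) :
  exists2 c : R[i], c != 0 & forall i, zeta (Ppoint z) i = c * val z ord0 i.
Proof.
rewrite /zeta; have /eqmodP /= : \pi_(P2 R) z = \pi_(P2 R) (repr (Ppoint z)).
  by rewrite reprK.
by case/asboolP=> c c0 e; exists c => // i; rewrite e mxE.
Qed.

Definition U (R : realType) (i : 'I_3) (p : P2 R) : Prop := zeta p i != 0.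

Definition w (R : realType) (i j : 'I_3) (p : P2 R) : R[i] :=
  zeta p j / zeta p i.

Lemma U_Ppoint (R : realType) (i : 'I_3) (z : hcoord R) :
  U i (Ppoint z) <-> val z ord0 i != 0.
Proof.
have [c c0 e] := zeta_Ppoint z.
by rewrite /U e mulf_eq0 (negbTE c0).
Qed.

Lemma w_Ppoint (R : realType) (i j : 'I_3) (z : hcoord R) :
  w i j (Ppoint z) = val z ord0 j / val z ord0 i.
Proof.
have [c c0 e] := zeta_Ppoint z.
by rewrite /w !e invfM mulrACA divff // mul1r.
Qed.

Definition k0 : 'I_3 := @Ordinal 3 0 isT.
Definition k1 : 'I_3 := @Ordinal 3 1 isT.
Definition k2 : 'I_3 := @Ordinal 3 2 isT.

(* Regular functions on the intersection of the U_i, i in I: quotients of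
   degree 0 of a form by a power of the product of the zeta^i, i in I. *)
Definition regular (R : realType) (I : {set 'I_3}) (f : P2 R -> R[i]) : Prop :=
  exists (N : nat) (F : {mpoly R[i][3]}),
    F \is (#|I| * N)%N.-homog /\
    forall p, (forall i, i \in I -> U i p) ->
      f p = F.@[zeta p] / (\prod_(i in I) zeta p i) ^+ N.

Definition Cstar (R : realType) := {x : R[i] | x != 0}.

Definition Cstar1 (R : realType) : Cstar R := exist _ 1 (oner_neq0 _).

Definition Cstar_mul (R : realType) (x y : Cstar R) : Cstar R :=
  exist _ (val x * val y) (mulf_neq0 (valP x) (valP y)).

Definition torus (R : realType) := (Cstar R * Cstar R)%type.

Definition torus1 (R : realType) : torus R := (Cstar1 R, Cstar1 R).

Definition torus_mul (R : realType) (s t : torus R) : torus R :=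
  (Cstar_mul s.1 t.1, Cstar_mul s.2 t.2).

Definition torus_scale (R : realType) (t : torus R) (j : 'I_3) : R[i] :=
  nth 0 [:: 1; val t.1; val t.2] j.

Lemma torus_scale_neq0 (R : realType) (t : torus R) j : torus_scale t j != 0.
Proof.
by case: j => -[|[|[|//]]] ?; rewrite /torus_scale /= ?oner_eq0 ?(valP t.1) ?(valP t.2).
Qed.

Lemma hcoord_act_subproof (R : realType) (t : torus R) (z : hcoord R) :
  \row_j (torus_scale t j * val z ord0 j) != 0.
Proof.
apply: contraNneq (valP z) => e; apply/eqP/rowP => j.
move/rowP/(_ j)/eqP: e; rewrite !mxE mulf_eq0 (negbTE (torus_scale_neq0 t j)).
by move/eqP.
Qed.

Definition hcoord_act (R : realType) (t : torus R) (z : hcoord R) : hcoord R :=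
  exist _ (\row_j (torus_scale t j * val z ord0 j)) (hcoord_act_subproof t z).

(* (l1, l2) . [z^0 : z^1 : z^2] = [z^0 : l1 z^1 : l2 z^2] *)
Definition P2_act (R : realType) (t : torus R) (p : P2 R) : P2 R :=
  Ppoint (hcoord_act t (repr p)).

Lemma P2_act_Ppoint (R : realType) (t : torus R) (z : hcoord R) :
  P2_act t (Ppoint z) = Ppoint (hcoord_act t z).
Proof.
have [c c0 e] := zeta_Ppoint z; apply/eqmodP/asboolP.
exists c^-1; first by rewrite invr_eq0.
apply/rowP => j; by rewrite !mxE -/(zeta (Ppoint z) j) e mulrCA mulKf.
Qed.

Lemma U_act (R : realType) (i : 'I_3) (t : torus R) (p : P2 R) :
  U i (P2_act t p) <-> U i p.
Proof.
by rewrite /P2_act U_Ppoint mxE mulf_eq0 (negbTE (torus_scale_neq0 t i)).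
Qed.

Lemma w_act (R : realType) (i j : 'I_3) (t : torus R) (p : P2 R) :
  w i j (P2_act t p) = torus_scale t j / torus_scale t i * w i j p.
Proof. by rewrite /P2_act w_Ppoint !mxE invfM mulrACA. Qed.

(* Functions on torus * U_i that are regular: Laurent polynomials in
   (l1, l2) with coefficients regular on U_i. *)
Definition torus_regular (R : realType) (i : 'I_3)
    (f : torus R -> P2 R -> R[i]) : Prop :=
  exists (K : nat) (r s : 'I_K -> int) (c : 'I_K -> P2 R -> R[i]),
    (forall k, regular [set i] (c k)) /\
    forall t p, U i p ->
      f t p = \sum_(k < K) (val t.1) ^ (r k) * (val t.2) ^ (s k) * c k p.

(* t maps fibre coordinates over U_j to fibre coordinates over U_i and is a
   morphism from the intersection of U_i and U_j to GL_2. *)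
Definition transition_function (R : realType) (i j : 'I_3)
    (t : P2 R -> 'M[R[i]]_2) : Prop :=
  (forall r c, regular [set i; j] (fun p => t p r c)) /\
  (forall p, U i p -> U j p -> t p \in unitmx).

(* An algebraic rank 2 vector bundle on P^2 trivialised over U_0, U_1, U_2,
   with the given transition functions; its algebraic structure and the linear
   structure of its fibres are those for which the trivialisations are
   isomorphisms. Only the values of triv i over U_i are meaningful. *)
Record bundle (R : realType) (t10 t21 t02 : P2 R -> 'M[R[i]]_2) := Bundle {
  total : Type;
  proj : total -> P2 R;
  triv : 'I_3 -> total -> 'cV[R[i]]_2;
  triv_bij : forall i p, U i p ->
    forall v, exists! e, proj e = p /\ triv i e = v;
  trans10 : transition_function k1 k0 t10;
  trans21 : transition_function k2 k1 t21;
  trans02 : transition_function k0 k2 t02;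
  triv10 : forall e, U k0 (proj e) -> U k1 (proj e) ->
    triv k1 e = t10 (proj e) *m triv k0 e;
  triv21 : forall e, U k1 (proj e) -> U k2 (proj e) ->
    triv k2 e = t21 (proj e) *m triv k1 e;
  triv02 : forall e, U k2 (proj e) -> U k0 (proj e) ->
    triv k0 e = t02 (proj e) *m triv k2 e }.

(* A lift of the torus action on P^2 to an algebraic action on the total
   space that is linear on fibres. *)
Record equivariant_structure (R : realType) (t10 t21 t02 : P2 R -> 'M[R[i]]_2)
    (E : bundle t10 t21 t02) := EquivariantStructure {
  act : torus R -> total E -> total E;
  act1 : forall e, act (torus1 R) e = e;
  actM : forall s t e, act (torus_mul s t) e = act s (act t e);
  act_proj : forall t e, proj (act t e) = P2_act t (proj e);
  act_linear : forall i, exists A : torus R -> P2 R -> 'M[R[i]]_2,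
    (forall r c, torus_regular i (fun t p => A t p r c)) /\
    forall t e, U i (proj e) -> triv i (act t e) = A t (proj e) *m triv i e }.

Definition mx22 (K : Type) (x y z u : K) : 'M[K]_2 :=
  \matrix_(i, j) (if i == ord0 then if j == ord0 then x else y
                  else if j == ord0 then z else u).

(* The other two indices in increasing order: (w_i^j, w_i^k) are the affine
   coordinates on U_i. *)
Definition others (i : 'I_3) : 'I_3 * 'I_3 :=
  nth (k1, k2) [:: (k1, k2); (k0, k2); (k0, k1)] i.

(* Fibre coordinates are ordered (+, -) over U_0, (-, +) over U_1 and
   (+, -) over U_2. *)
Definition local_fibre (R : realType) (m n : int) (i : 'I_3) (t : torus R) :
    'M[R[i]]_2 :=
  let l1 := val t.1 in let l2 := val t.2 in
  match val i with
  | 0%N => mx22 (l1 ^ (m - n)) 0 0 (l2 ^ (m - n))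
  | 1%N => mx22 (l1 ^ (- n)) 0 0 (l1 ^ (- n) * l2 ^ (m - n))
  | _ => mx22 (l2 ^ (- n)) 0 0 (l1 ^ (m - n) * l2 ^ (- n))
  end.

Definition local_base (R : realType) (i : 'I_3) (t : torus R)
    (x : R[i] * R[i]) : R[i] * R[i] :=
  let l1 := val t.1 in let l2 := val t.2 in
  match val i with
  | 0%N => (l1 * x.1, l2 * x.2)
  | 1%N => (l1^-1 * x.1, l1^-1 * l2 * x.2)
  | _ => (l2^-1 * x.1, l1 * l2^-1 * x.2)
  end.

Definition extends_local (R : realType) (m n : int)
    (t10 t21 t02 : P2 R -> 'M[R[i]]_2) (E : bundle t10 t21 t02)
    (S : equivariant_structure E) : Prop :=
  forall i t e, U i (proj e) ->
    let: (j, k) := others i in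
    (w i j (proj (act S t e)), w i k (proj (act S t e))) =
      local_base i t (w i j (proj e), w i k (proj e)) /\
    triv i (act S t e) = local_fibre m n i t *m triv i e.

Definition compatible (R : realType) (m n : int) (i j : 'I_3)
    (tau : P2 R -> 'M[R[i]]_2) : Prop :=
  forall t p, U i p -> U j p ->
    tau (P2_act t p) *m local_fibre m n j t =
    local_fibre m n i t *m tau p.

Definition tausf10 (R : realType) (m n : int) (a b : 'I_3 -> R[i])
    (p : P2 R) : 'M[R[i]]_2 :=
  mx22 (a k0 / w k0 k1 p ^ m) 0 0 (b k0 / w k0 k1 p ^ n).

Definition tausf21 (R : realType) (m n : int) (a b : 'I_3 -> R[i])
    (p : P2 R) : 'M[R[i]]_2 :=
  mx22 (b k1 / w k1 k2 p ^ n) 0 0 (a k1 / w k1 k2 p ^ m).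

Definition tausf02 (R : realType) (m n : int) (a b : 'I_3 -> R[i])
    (p : P2 R) : 'M[R[i]]_2 :=
  mx22 0 (b k2 / w k2 k0 p ^ n) (a k2 / w k2 k0 p ^ m) 0.

(* The Theta are used only for m != n, so the else branches mean m < n. *)
Definition Theta10 (R : realType) (m n : int) (a b : 'I_3 -> R[i])
    (p : P2 R) : 'M[R[i]]_2 :=
  1%:M + if n < m
    then mx22 0 0 (- (a k0 * b k1 * a k2) * (w k0 k2 p / w k0 k1 p) ^ (m - n)) 0
    else mx22 0 (- (b k0 * a k1 * b k2) * (w k0 k2 p / w k0 k1 p) ^ (n - m)) 0 0.

Definition Theta21 (R : realType) (m n : int) (a b : 'I_3 -> R[i])
    (p : P2 R) : 'M[R[i]]_2 :=
  1%:M + if n < m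
    then mx22 0 (- (a k0 * a k1 * b k2) * (w k1 k0 p / w k1 k2 p) ^ (m - n)) 0 0
    else mx22 0 0 (- (b k0 * b k1 * a k2) * (w k1 k0 p / w k1 k2 p) ^ (n - m)) 0.

Definition Theta02 (R : realType) (m n : int) (a b : 'I_3 -> R[i])
    (p : P2 R) : 'M[R[i]]_2 :=
  1%:M + if n < m
    then mx22 0 0 (- (b k0 * a k1 * a k2) * (w k2 k1 p / w k2 k0 p) ^ (m - n)) 0
    else mx22 0 (- (a k0 * b k1 * b k2) * (w k2 k1 p / w k2 k0 p) ^ (n - m)) 0 0.

Definition tau10 (R : realType) (m n : int) (a b : 'I_3 -> R[i]) (p : P2 R) :=
  tausf10 m n a b p *m Theta10 m n a b p.

Definition tau21 (R : realType) (m n : int) (a b : 'I_3 -> R[i]) (p : P2 R) :=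
  tausf21 m n a b p *m Theta21 m n a b p.

Definition tau02 (R : realType) (m n : int) (a b : 'I_3 -> R[i]) (p : P2 R) :=
  tausf02 m n a b p *m Theta02 m n a b p.

(* Main.v *)
Require Import Defs.
From mathcomp Require Import all_boot all_order all_algebra.
From mathcomp Require Import reals complex.
From mathcomp Require Import boolp mpoly ring.
Import Order.TTheory GRing.Theory Num.Theory.
Local Open Scope ring_scope.
Set Implicit Arguments.
Unset Strict Implicit.

(** Write x = ζ^1/ζ^0, u = ζ^2/ζ^1 and s = ζ^0/ζ^2, so that x u s = 1 wherever
all three are defined.  The ratio of affine coordinates in Θ_10 is u, the one
in Θ_21 is s and the one in Θ_02 is x, so every entry of a corrected transition
matrix is a constant times a Laurent monomial in these three functions
([tau10E], [tau21E], [tau02E]).  Everything follows from this normal form.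

Cocycle condition ([tau_cocycle]).  Each naive matrix is diagonal except for
τ_02, which swaps the two summands, so the naive product is antidiagonal and
is not the identity.  The corrections add further monomials to the entries of
the product; eliminating s and b_2 by means of x u s = 1 and ∏ a_i b_i = -1, the
diagonal entries become 1 and the off-diagonal ones cancel.

The transition matrices are morphisms to GL_2 on the double overlaps: a naive
factor involves only the ratio of the two coordinates that are invertible there,
the third coordinate occurs only in Θ, with a positive exponent |m - n|, and
the determinant is a single monomial.  Together with the cocycle condition this
gives a bundle ([bundle_glue]).

Equivariance.  The torus multiplies x, u and s by λ_1, λ_2/λ_1 and 1/λ_2, and
the weights of the fibre coordinates are exactly those that make each monomial
entry of τ_ij homogeneous of the right weight; this is the compatibility of the
local actions with the τ_ij.  Compatible local actions define one action on any
bundle with these transition functions ([equivariant_extension]): the image of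
a vector e over p is the unique vector over t p with the prescribed fibre
coordinate in one chart around p, and then in all of them. *)

(** * Two by two matrices *)

Lemma eq_mx22 (K : Type) (x y z u x' y' z' u' : K) :
  x = x' -> y = y' -> z = z' -> u = u' -> mx22 x y z u = mx22 x' y' z' u'.
Proof. by move=> -> -> -> ->. Qed.

Lemma mx22_1 (K : pzRingType) : 1%:M = mx22 1 0 0 1 :> 'M[K]_2.
Proof. by apply/matrixP => -[[|[|//]] ?] [[|[|//]] ?]; rewrite !mxE. Qed.

Lemma mx22D (K : pzRingType) (x y z u x' y' z' u' : K) :
  mx22 x y z u + mx22 x' y' z' u' = mx22 (x + x') (y + y') (z + z') (u + u').
Proof. by apply/matrixP => -[[|[|//]] ?] [[|[|//]] ?]; rewrite !mxE. Qed.

Lemma mx22M (K : pzRingType) (x y z u x' y' z' u' : K) :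
  mx22 x y z u *m mx22 x' y' z' u' =
  mx22 (x * x' + y * z') (x * y' + y * u') (z * x' + u * z') (z * y' + u * u').
Proof.
by apply/matrixP => -[[|[|//]] ?] [[|[|//]] ?];
  rewrite !mxE big_ord_recl big_ord1 !mxE.
Qed.

Lemma mx22_unit (K : fieldType) (x y z u : K) :
  (mx22 x y z u \in unitmx) = (x * u - y * z != 0).
Proof.
rewrite unitmxE unitfE (expand_det_row _ ord0) big_ord_recl big_ord1.
by rewrite /cofactor !det_mx11 !mxE /= expr0 mul1r expr1 mulN1r mulrN.
Qed.

(** * Ratios of homogeneous coordinates *)

Lemma w_neq0 (R : realType) (i j : 'I_3) (p : P2 R) :
  U i p -> U j p -> w i j p != 0.
Proof. by move=> pi pj; rewrite mulf_neq0 ?invr_eq0. Qed.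

(** Division by 0 gives 0, so both sides are 0 where ζ^k vanishes. *)
Lemma w_ratio (R : realType) (i j k : 'I_3) (p : P2 R) :
  U i p -> w i j p / w i k p = w k j p.
Proof.
by move=> pi; rewrite /w invf_div mulrACA [_^-1 * _]mulrC mulrACA divff ?mul1r
  // mulr1.
Qed.

(** This is x u s = 1, solved for s. *)
Lemma w_cycle (R : realType) (p : P2 R) : U k0 p -> U k1 p -> U k2 p ->
  w k2 k0 p = (w k0 k1 p * w k1 k2 p)^-1.
Proof.
move=> p0 p1 p2; rewrite -[_ * w _ _ p]mulrC /w mulrA divfK //.
by rewrite invf_div.
Qed.

Lemma P2_cover (R : realType) (p : P2 R) : exists i, U i p.
Proof.
have /rV0Pn[i pi] := valP (repr p); by exists i.
Qed.

Lemma P2_act1 (R : realType) (p : P2 R) : P2_act (torus1 R) p = p.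
Proof.
rewrite -[RHS]reprK; apply/eqmodP/asboolP; exists 1; first exact: oner_neq0.
by apply/rowP => -[[|[|[|//]]] ?]; rewrite !mxE /torus_scale /= !mul1r.
Qed.

Lemma P2_actM (R : realType) (s t : torus R) (p : P2 R) :
  P2_act (torus_mul s t) p = P2_act s (P2_act t p).
Proof.
rewrite {3}/P2_act P2_act_Ppoint; congr Ppoint; apply/val_inj/rowP.
by case=> -[|[|[|//]]] ?; rewrite !mxE /torus_scale /= ?mul1r ?mulrA.
Qed.

(** * Regular functions *)

Lemma regular_ext (R : realType) (I : {set 'I_3}) (f g : P2 R -> R[i]) :
  (forall p, (forall i, i \in I -> U i p) -> f p = g p) ->
  regular I g -> regular I f.
Proof.
by move=> fg [N [F [hF gE]]]; exists N, F; split=> // p pI; rewrite fg ?gE.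
Qed.

Lemma regular_cst (R : realType) (I : {set 'I_3}) (c : R[i]) :
  regular I (fun=> c).
Proof.
exists 0%N, (c%:MP); split=> [|p _]; last by rewrite mevalC expr0 divr1.
by rewrite muln0 -[c]mulr1 mpolyCM mul_mpolyC rpredZ // dhomog1.
Qed.

Lemma regularM (R : realType) (I : {set 'I_3}) (f g : P2 R -> R[i]) :
  regular I f -> regular I g -> regular I (fun p => f p * g p).
Proof.
move=> [N [F [hF fE]]] [M [G [hG gE]]]; exists (N + M)%N, (F * G).
split=> [|p pI]; first by rewrite mulnDr dhomogM.
by rewrite fE // gE // mevalM exprD invfM mulrACA.
Qed.

Lemma regularX (R : realType) (I : {set 'I_3}) (f : P2 R -> R[i]) (n : nat) :
  regular I f -> regular I (fun p => f p ^+ n).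
Proof.
move=> fr; elim: n => [|n IHn]; first exact: (regular_cst I 1).
by apply: (regular_ext (g := fun p => f p * f p ^+ n)) (regularM fr IHn)
  => p _; rewrite exprS.
Qed.

Lemma dhomog_prodX (K : nzRingType) (A : {set 'I_3}) :
  (\prod_(i in A) 'X_i : {mpoly K[3]}) \is #|A|.-homog.
Proof.
rewrite -sum1_card.
apply: (big_rec2 (fun (F : {mpoly K[3]}) (d : nat) => F \is d.-homog)).
  exact: dhomog1.
by move=> i F d _ hF; rewrite dhomogM // dhomogX; apply/eqP; rewrite /= mdeg1.
Qed.

(** ζ^j/ζ^i is brought to the denominator prescribed by [regular] by
multiplying with the other coordinates that are invertible on the chart. *)
Lemma regular_w (R : realType) (I : {set 'I_3}) (i j : 'I_3) :
  i \in I -> regular I (@w R i j).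
Proof.
move=> iI; exists 1%N, ('X_j * \prod_(k in I :\ i) 'X_k); split=> [|p pI].
  rewrite muln1 (cardsD1 i) iI dhomogM ?dhomog_prodX // dhomogX.
  by apply/eqP; rewrite /= mdeg1.
rewrite mevalM mevalXU (big_morph _ (mevalM (zeta p)) (meval1 _)).
under eq_bigr do rewrite mevalXU.
rewrite expr1 [X in _ / X](big_setD1 i) //= invfM mulrACA divff ?mulr1 //.
by apply/prodf_neq0 => k; rewrite !inE => /andP[_ kI]; apply: pI.
Qed.

(** A negative power of ζ^j/ζ^i is a positive power of ζ^i/ζ^j, so that both
coordinates have to be invertible, unlike in [regular_wz_ge0]. *)
Lemma regular_wz (R : realType) (I : {set 'I_3}) (i j : 'I_3) (z : int) :
  i \in I -> j \in I -> regular I (fun p : P2 R => w i j p ^ z).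
Proof.
move=> iI jI; case: z => n; first exact/regularX/regular_w.
apply: (regular_ext (g := fun p => w j i p ^+ n.+1)).
  by move=> p _; rewrite NegzE -exprz_inv /w invf_div.
exact/regularX/regular_w.
Qed.

Lemma regular_wz_ge0 (R : realType) (I : {set 'I_3}) (i j : 'I_3) (z : int) :
  i \in I -> 0 <= z -> regular I (fun p : P2 R => w i j p ^ z).
Proof. by move=> iI; case: z => // n _; apply/regularX/regular_w. Qed.

Lemma transition_mx22 (R : realType) (i j : 'I_3) (t : P2 R -> 'M[R[i]]_2)
    (x y z u : P2 R -> R[i]) :
  (forall p, U i p -> U j p -> t p = mx22 (x p) (y p) (z p) (u p)) ->
  regular [set i; j] x -> regular [set i; j] y ->
  regular [set i; j] z -> regular [set i; j] u ->
  (forall p, U i p -> U j p -> x p * u p - y p * z p != 0) ->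
  transition_function i j t.
Proof.
move=> tE rx ry rz ru d0; split=> [r c|p pi pj]; last first.
  by rewrite tE // mx22_unit d0.
pose f p := mx22 (x p) (y p) (z p) (u p) r c.
apply: (regular_ext (g := f)) => [p pI|].
  by rewrite tE //; apply: pI; rewrite !inE eqxx ?orbT.
rewrite /f; case: r c {f} => -[|[|//]] ? [[|[|//]] ?].
- by apply: regular_ext rx => p _; rewrite mxE.
- by apply: regular_ext ry => p _; rewrite mxE.
- by apply: regular_ext rz => p _; rewrite mxE.
- by apply: regular_ext ru => p _; rewrite mxE.
Qed.

(** * The transition functions *)

(** A factor gets an arbitrary exponent if both of its coordinates are
invertible on the overlap; otherwise the sign of the exponent is needed. *)
Ltac regular_monomial :=
  repeat first
    [ exact: regular_cst
    | apply: regularM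
    | by apply: regular_wz; rewrite !inE
    | by apply: regular_wz_ge0; rewrite ?inE ?subr_ge0 // ltW ].

Lemma tau10E (R : realType) (m n : int) (a b : 'I_3 -> R[i]) (p : P2 R) :
  U k0 p ->
  tau10 m n a b p =
  if n < m then
    mx22 (a k0 * w k0 k1 p ^ (- m)) 0
      (- (a k0 * b k0 * b k1 * a k2) *
         (w k0 k1 p ^ (- n) * w k1 k2 p ^ (m - n)))
      (b k0 * w k0 k1 p ^ (- n))
  else
    mx22 (a k0 * w k0 k1 p ^ (- m))
      (- (a k0 * b k0 * a k1 * b k2) *
         (w k0 k1 p ^ (- m) * w k1 k2 p ^ (n - m)))
      0 (b k0 * w k0 k1 p ^ (- n)).
Proof.
move=> p0; rewrite /tau10 /tausf10 /Theta10 w_ratio // !invr_expz mx22_1.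
by case: ifP => _; rewrite mx22D mx22M; apply: eq_mx22; ring.
Qed.

Lemma tau21E (R : realType) (m n : int) (a b : 'I_3 -> R[i]) (p : P2 R) :
  U k1 p ->
  tau21 m n a b p =
  if n < m then
    mx22 (b k1 * w k1 k2 p ^ (- n))
      (- (a k0 * a k1 * b k1 * b k2) *
         (w k1 k2 p ^ (- n) * w k2 k0 p ^ (m - n)))
      0 (a k1 * w k1 k2 p ^ (- m))
  else
    mx22 (b k1 * w k1 k2 p ^ (- n)) 0
      (- (b k0 * a k1 * b k1 * a k2) *
         (w k1 k2 p ^ (- m) * w k2 k0 p ^ (n - m)))
      (a k1 * w k1 k2 p ^ (- m)).
Proof.
move=> p1; rewrite /tau21 /tausf21 /Theta21 w_ratio // !invr_expz mx22_1.
by case: ifP => _; rewrite mx22D mx22M; apply: eq_mx22; ring.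
Qed.

Lemma tau02E (R : realType) (m n : int) (a b : 'I_3 -> R[i]) (p : P2 R) :
  U k2 p ->
  tau02 m n a b p =
  if n < m then
    mx22 (- (b k0 * a k1 * a k2 * b k2) *
            (w k2 k0 p ^ (- n) * w k0 k1 p ^ (m - n)))
      (b k2 * w k2 k0 p ^ (- n)) (a k2 * w k2 k0 p ^ (- m)) 0
  else
    mx22 0 (b k2 * w k2 k0 p ^ (- n)) (a k2 * w k2 k0 p ^ (- m))
      (- (a k0 * b k1 * a k2 * b k2) *
         (w k2 k0 p ^ (- m) * w k0 k1 p ^ (n - m))).
Proof.
move=> p2; rewrite /tau02 /tausf02 /Theta02 w_ratio // !invr_expz mx22_1.
by case: ifP => _; rewrite mx22D mx22M; apply: eq_mx22; ring.
Qed.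

Lemma tau10_transition (R : realType) (m n : int) (a b : 'I_3 -> R[i]) :
  (forall i, a i != 0) -> (forall i, b i != 0) ->
  transition_function k1 k0 (tau10 m n a b).
Proof.
move=> a0 b0; case: (ltP n m) => nm.
  apply: transition_mx22 => [p _ p0|||||p p1 p0];
    first by rewrite tau10E // nm.
  all: try by regular_monomial.
  by rewrite /= mul0r subr0 !mulf_neq0 ?expfz_neq0 ?w_neq0.
apply: transition_mx22 => [p _ p0|||||p p1 p0];
  first by rewrite tau10E // ltNge nm.
all: try by regular_monomial.
by rewrite /= mulr0 subr0 !mulf_neq0 ?expfz_neq0 ?w_neq0.
Qed.

Lemma tau21_transition (R : realType) (m n : int) (a b : 'I_3 -> R[i]) :
  (forall i, a i != 0) -> (forall i, b i != 0) ->
  transition_function k2 k1 (tau21 m n a b).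
Proof.
move=> a0 b0; case: (ltP n m) => nm.
  apply: transition_mx22 => [p _ p0|||||p p1 p0];
    first by rewrite tau21E // nm.
  all: try by regular_monomial.
  by rewrite /= mulr0 subr0 !mulf_neq0 ?expfz_neq0 ?w_neq0.
apply: transition_mx22 => [p _ p0|||||p p1 p0];
  first by rewrite tau21E // ltNge nm.
all: try by regular_monomial.
by rewrite /= mul0r subr0 !mulf_neq0 ?expfz_neq0 ?w_neq0.
Qed.

Lemma tau02_transition (R : realType) (m n : int) (a b : 'I_3 -> R[i]) :
  (forall i, a i != 0) -> (forall i, b i != 0) ->
  transition_function k0 k2 (tau02 m n a b).
Proof.
move=> a0 b0; case: (ltP n m) => nm.
  apply: transition_mx22 => [p _ p0|||||p p1 p0];
    first by rewrite tau02E // nm.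
  all: try by regular_monomial.
  by rewrite /= mulr0 sub0r oppr_eq0 !mulf_neq0 ?expfz_neq0 ?w_neq0.
apply: transition_mx22 => [p _ p0|||||p p1 p0];
  first by rewrite tau02E // ltNge nm.
all: try by regular_monomial.
by rewrite /= mul0r sub0r oppr_eq0 !mulf_neq0 ?expfz_neq0 ?w_neq0.
Qed.

(** The exponents are written in terms of n and d = m - n.  After the elimination
of s and b_2, the identity becomes, in both cases of Θ, one of rational
functions in x^n, x^d, u^n, u^d and the remaining constants, in which the
powers can be treated as independent variables. *)
Lemma tau_cocycle (R : realType) (m n : int) (a b : 'I_3 -> R[i]) (p : P2 R) :
  (forall i, a i != 0) -> (forall i, b i != 0) ->
  \prod_(i < 3) (a i * b i) = -1 ->
  U k0 p -> U k1 p -> U k2 p ->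
  tau02 m n a b p *m tau21 m n a b p *m tau10 m n a b p = 1%:M.
Proof.
move=> a0 b0 ab p0 p1 p2.
have abE : a k0 * b k0 * (a k1 * b k1) * (a k2 * b k2) = -1.
  rewrite -ab !big_ord_recl big_ord0 mulr1 [RHS]mulrA.
  have -> : k0 = ord0 by apply: val_inj.
  have -> : k1 = lift ord0 ord0 by apply: val_inj.
  by have -> : k2 = lift ord0 (lift ord0 ord0) by apply: val_inj.
have b2E : b k2 = - (a k0 * b k0 * (a k1 * b k1) * a k2)^-1.
  apply: (@mulfI _ (a k0 * b k0 * (a k1 * b k1) * a k2)).
    by rewrite !mulf_neq0.
  by rewrite mulrN divff ?mulf_neq0 // -abE !mulrA.
have [d ->] : exists d, m = n + d by exists (m - n); rewrite addrC subrK.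
rewrite tau02E // tau21E // tau10E // w_cycle // b2E.
move: (w_neq0 p0 p1) (w_neq0 p1 p2).
move: (w k0 k1 p) (w k1 k2 p) => x u x0 u0.
have e1 : n - (n + d) = - d by rewrite opprD addNKr.
have e2 : n + d - n = d by rewrite addrAC subrr add0r.
rewrite e1 e2 !exprz_inv !opprK !expfzMl !opprD !expfzDr // -!invr_expz.
have [xn0 xd0] := (expfz_neq0 n x0, expfz_neq0 d x0).
have [un0 ud0] := (expfz_neq0 n u0, expfz_neq0 d u0).
move: (a0 k0) (b0 k0) (a0 k1) (b0 k1) (a0 k2).
move: xn0 xd0 un0 ud0.
move: (x ^ n) (x ^ d) (u ^ n) (u ^ d) (a k0) (b k0) (a k1) (b k1) (a k2).
move=> {abE b2E ab} X X' Y Y' A0 B0 A1 B1 A2 ? ? ? ? ? ? ? ? ?.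
case: ifP => _; rewrite !mx22M mx22_1; apply: eq_mx22; field.
all: by do ?[apply/andP; split].
Qed.

(** Of the two functions in the entries of a transition matrix, only [x] is
invertible on the whole overlap; [u] enters both sides with the same exponent.
So the powers of [u] are generalized before negative powers become inverses,
and [field] never asks for [u] to be nonzero.  The powers of [x], [l1] and [l2]
are generalized as well: they too can be treated as independent variables. *)
Ltac compare_weights n d x u l1 l2 x0 l10 l20 :=
  rewrite (_ : n - (n + d) = - d) ?opprD ?addNKr //;
  rewrite (_ : n + d - n = d) 1?addrAC ?subrr ?add0r //;
  rewrite !expfzMl !exprz_inv ?opprD ?opprK !expfzDr //;
  move: (u ^ d) (u ^ - d) => ? ?; rewrite -!invr_expz;
  move: (expfz_neq0 n x0) (expfz_neq0 d x0) (expfz_neq0 n l10)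
    (expfz_neq0 d l10) (expfz_neq0 n l20) (expfz_neq0 d l20);
  move: (x ^ n) (x ^ d) (l1 ^ n) (l1 ^ d) (l2 ^ n) (l2 ^ d);
  move=> ? ? ? ? ? ? ? ? ? ? ? ?;
  case: ifP => _; rewrite !mx22M; apply: eq_mx22; field;
  do ?[apply/andP; split=> //]; by [].

Lemma tau10_compatible (R : realType) (m n : int) (a b : 'I_3 -> R[i]) :
  compatible m n k1 k0 (tau10 m n a b).
Proof.
move=> [[l1 l10] [l2 l20]] p p1 p0; rewrite !tau10E //; last exact/U_act.
rewrite !w_act /local_fibre /torus_scale /= divr1.
move: (w_neq0 p0 p1); move: (w k0 k1 p) (w k1 k2 p) => x u x0.
have [d ->] : exists d, m = n + d by exists (m - n); rewrite addrC subrK.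
compare_weights n d x u l1 l2 x0 l10 l20.
Qed.

Lemma tau21_compatible (R : realType) (m n : int) (a b : 'I_3 -> R[i]) :
  compatible m n k2 k1 (tau21 m n a b).
Proof.
move=> [[l1 l10] [l2 l20]] p p2 p1; rewrite !tau21E //; last exact/U_act.
rewrite !w_act /local_fibre /torus_scale /= div1r.
move: (w_neq0 p1 p2); move: (w k1 k2 p) (w k2 k0 p) => x u x0.
have [d ->] : exists d, m = n + d by exists (m - n); rewrite addrC subrK.
compare_weights n d x u l1 l2 x0 l10 l20.
Qed.

Lemma tau02_compatible (R : realType) (m n : int) (a b : 'I_3 -> R[i]) :
  compatible m n k0 k2 (tau02 m n a b).
Proof.
move=> [[l1 l10] [l2 l20]] p p0 p2; rewrite !tau02E //; last exact/U_act.
rewrite !w_act /local_fibre /torus_scale /= div1r divr1.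
move: (w_neq0 p2 p0); move: (w k2 k0 p) (w k0 k1 p) => x u x0.
have [d ->] : exists d, m = n + d by exists (m - n); rewrite addrC subrK.
compare_weights n d x u l1 l2 x0 l10 l20.
Qed.

(** * Gluing a bundle from its transition functions *)

Lemma k_cases (P : 'I_3 -> Prop) : P k0 -> P k1 -> P k2 -> forall i, P i.
Proof.
move=> P0 P1 P2 [[|[|[|//]]] lt]; [move: P0|move: P1|move: P2];
  by congr P; apply: val_inj.
Qed.

(** The total space is P^2 x C^2: the fibre over p is identified with C^2 by the
first chart that contains p, and [g i p] is the change from that chart to the
i-th one.  The product is a total space only as a set; the algebraic structure
is the one carried by the trivialisations. *)
Lemma bundle_glue (R : realType) (t10 t21 t02 : P2 R -> 'M[R[i]]_2) :
  transition_function k1 k0 t10 -> transition_function k2 k1 t21 ->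
  transition_function k0 k2 t02 ->
  (forall p, U k0 p -> U k1 p -> U k2 p ->
     t02 p *m t21 p *m t10 p = 1%:M) ->
  inhabited (bundle t10 t21 t02).
Proof.
move=> h10 h21 h02 cocycle.
pose g (i : 'I_3) (p : P2 R) : 'M[R[i]]_2 :=
  if zeta p k0 != 0 then
    nth 1%:M [:: 1%:M; t10 p; invmx (t02 p)] i
  else if zeta p k1 != 0 then nth 1%:M [:: 1%:M; 1%:M; t21 p] i
  else 1%:M.
have g_unit i p : U i p -> g i p \in unitmx.
  elim/k_cases: i => pi; rewrite /g /=; do 2?[case: ifP => ?];
    rewrite ?unitmx_inv ?unitmx1 //.
  - by apply: h10.2.
  - by apply: h02.2.
  - by apply: h21.2.
have bij i p : U i p -> forall v, exists! e : P2 R * 'cV[R[i]]_2,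
    e.1 = p /\ g i e.1 *m e.2 = v.
  move=> pi v; exists (p, invmx (g i p) *m v); split=> /=.
    by rewrite mulmxA mulmxV ?mul1mx ?g_unit.
  by move=> [_ v'] /= [-> <-]; rewrite mulKmx ?g_unit.
have glue i j t : (forall p, U j p -> U i p -> g i p = t p *m g j p) ->
    forall e : P2 R * 'cV[R[i]]_2, U j e.1 -> U i e.1 ->
    g i e.1 *m e.2 = t e.1 *m (g j e.1 *m e.2).
  by move=> gE e ej ei; rewrite gE // mulmxA.
split; apply: (@Bundle R t10 t21 t02 (P2 R * 'cV[R[i]]_2)%type fst
  (fun i e => g i e.1 *m e.2) bij h10 h21 h02); apply: glue => p.
- by move=> p0 p1; rewrite /g p0 mulmx1.
- move=> p1 p2; rewrite /g p1; case: ifP => [p0|_]; last by rewrite mulmx1.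
  (* Here g 1 = t10 and g 2 = t02^-1, so the cocycle condition is used. *)
  have u02 := h02.2 p p0 p2.
  by rewrite -[LHS]mulmx1 -(cocycle p) // -mulmxA mulKmx.
- by move=> p2 p0; rewrite /g p0 /= mulmxV ?h02.2.
Qed.

(** * Lifting the torus action *)

Lemma local_fibre1 (R : realType) (m n : int) (i : 'I_3) :
  local_fibre m n i (torus1 R) = 1%:M.
Proof.
by elim/k_cases: i; rewrite /local_fibre /= !exp1rz ?mulr1 mx22_1.
Qed.

Lemma local_fibreM (R : realType) (m n : int) (i : 'I_3) (s t : torus R) :
  local_fibre m n i (torus_mul s t) =
  local_fibre m n i s *m local_fibre m n i t.
Proof.
elim/k_cases: i; rewrite /local_fibre /= !expfzMl mx22M;
  apply: eq_mx22; ring.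
Qed.

Lemma torus_regular_monomial (R : realType) (i : 'I_3) (x y : int) (z : R[i]) :
  torus_regular i (fun t _ => val t.1 ^ x * val t.2 ^ y * z).
Proof.
exists 1%N, (fun=> x), (fun=> y), (fun _ _ => z); split=> [_|t p _].
  exact: regular_cst.
by rewrite big_ord1.
Qed.

Lemma local_fibre_regular (R : realType) (m n : int) (i : 'I_3) (r c : 'I_2) :
  torus_regular i (fun t (_ : P2 R) => local_fibre m n i t r c).
Proof.
suff [x [y [z E]]] : exists x y z, forall t : torus R,
    local_fibre m n i t r c = val t.1 ^ x * val t.2 ^ y * z.
  have [K [r' [s [c' [hc fE]]]]] := torus_regular_monomial i x y z.
  by exists K, r', s, c'; split=> // t p pi; rewrite E; apply: fE.
case: r c => -[|[|//]] ? [[|[|//]] ?]; try by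
  exists 0, 0, 0 => t; rewrite mulr0; elim/k_cases: i; rewrite mxE.
- elim/k_cases: i;
    [exists (m - n), 0, 1 | exists (- n), 0, 1 | exists 0, (- n), 1];
    by move=> t; rewrite mxE /= expr0z ?mulr1 ?mul1r.
- elim/k_cases: i; [exists 0, (m - n), 1 | exists (- n), (m - n), 1 |
    exists (m - n), (- n), 1];
    by move=> t; rewrite mxE /= ?expr0z ?mulr1 ?mul1r.
Qed.

Lemma local_base_act (R : realType) (i : 'I_3) (t : torus R) (p : P2 R) :
  let: (j, k) := others i in
  (w i j (P2_act t p), w i k (P2_act t p)) =
  local_base i t (w i j p, w i k p).
Proof.
elim/k_cases: i; rewrite /others /= !w_act /local_base /torus_scale /=.
- by rewrite !divr1.
- by rewrite div1r [val t.2 / _]mulrC.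
- by rewrite div1r.
Qed.

Lemma triv_inj (R : realType) (t10 t21 t02 : P2 R -> 'M[R[i]]_2)
    (E : bundle t10 t21 t02) (i : 'I_3) (e e' : Defs.total E) :
  U i (proj e) -> proj e = proj e' -> triv i e = triv i e' -> e = e'.
Proof.
move=> ei pe te; have [e'' [_ uniq]] := triv_bij E ei (triv i e').
by rewrite -(uniq e) // (uniq e').
Qed.

(** The two sides of the compatibility condition are the two ways to compute
the image of e in the chart i from its coordinate in the chart j; since tau is
invertible, the prescription can be moved in both directions. *)
Lemma compatible_transfer (R : realType) (m n : int)
    (t10 t21 t02 : P2 R -> 'M[R[i]]_2) (E : bundle t10 t21 t02)
    (i j : 'I_3) (tau : P2 R -> 'M[R[i]]_2) (t : torus R)
    (e e' : Defs.total E) :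
  compatible m n i j tau -> transition_function i j tau ->
  (forall e : Defs.total E, U j (proj e) -> U i (proj e) ->
     triv i e = tau (proj e) *m triv j e) ->
  proj e' = P2_act t (proj e) -> U i (proj e) -> U j (proj e) ->
  (triv j e' = local_fibre m n j t *m triv j e) <->
  (triv i e' = local_fibre m n i t *m triv i e).
Proof.
move=> comp [_ unit] tauE pe' ei ej.
have [ei' ej'] : U i (proj e') /\ U j (proj e').
  by rewrite pe'; split; apply/U_act.
rewrite !tauE // mulmxA -comp // -pe' -mulmxA; split=> [-> //|].
exact/can_inj/mulKmx/unit.
Qed.

(** The image is defined by one chart around e.  Any two charts are joined by one
of the three transition functions, in one of its two directions. *)
Lemma lift_ex (R : realType) (m n : int) (t10 t21 t02 : P2 R -> 'M[R[i]]_2)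
    (E : bundle t10 t21 t02) :
  compatible m n k1 k0 t10 -> compatible m n k2 k1 t21 ->
  compatible m n k0 k2 t02 ->
  forall (t : torus R) (e : Defs.total E), exists e' : Defs.total E,
    proj e' = P2_act t (proj e) /\
    forall i, U i (proj e) -> triv i e' = local_fibre m n i t *m triv i e.
Proof.
move=> c10 c21 c02 t e; have [i ei] := P2_cover (proj e).
have tei : U i (P2_act t (proj e)) by apply/U_act.
have [e' [[pe' te'] _]] := triv_bij E tei (local_fibre m n i t *m triv i e).
exists e'; split=> // j ej.
have h10 := compatible_transfer c10 (trans10 E) (@triv10 _ _ _ _ E) pe'.
have h21 := compatible_transfer c21 (trans21 E) (@triv21 _ _ _ _ E) pe'.
have h02 := compatible_transfer c02 (trans02 E) (@triv02 _ _ _ _ E) pe'.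
elim/k_cases: i ei te' {tei}; elim/k_cases: j ej => // ej ei; tauto.
Qed.

(** The axioms of an action follow from uniqueness: a vector is determined by its
base point and its coordinate in one chart ([triv_inj]), and [local_fibre] is
multiplicative in the torus element. *)
Lemma equivariant_extension (R : realType) (m n : int)
    (t10 t21 t02 : P2 R -> 'M[R[i]]_2) (E : bundle t10 t21 t02) :
  compatible m n k1 k0 t10 -> compatible m n k2 k1 t21 ->
  compatible m n k0 k2 t02 ->
  exists S : equivariant_structure E, extends_local m n S.
Proof.
move=> c10 c21 c02.
have /choice[f fP] : forall te : torus R * Defs.total E,
    exists e' : Defs.total E,
    proj e' = P2_act te.1 (proj te.2) /\
    forall i, U i (proj te.2) ->
      triv i e' = local_fibre m n i te.1 *m triv i te.2.
  by move=> te; apply: lift_ex.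
pose act t e := f (t, e).
have act_proj t e : proj (act t e) = P2_act t (proj e) by case: (fP (t, e)).
have act_triv t e i : U i (proj e) ->
    triv i (act t e) = local_fibre m n i t *m triv i e.
  by case: (fP (t, e)) => _; apply.
have act1 e : act (torus1 R) e = e.
  have [i ei] := P2_cover (proj e); apply/esym/(triv_inj (i := i)) => //.
    by rewrite act_proj P2_act1.
  by rewrite act_triv // local_fibre1 mul1mx.
have actM s t e : act (torus_mul s t) e = act s (act t e).
  have [i ei] := P2_cover (proj e); apply/esym/(triv_inj (i := i)).
  - by rewrite !act_proj; do 2!apply/U_act.
  - by rewrite !act_proj P2_actM.
  - rewrite !act_triv ?act_proj ?local_fibreM ?mulmxA //; exact/U_act.
have act_linear i : exists A : torus R -> P2 R -> 'M[R[i]]_2,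
    (forall r c, torus_regular i (fun t p => A t p r c)) /\
    forall t e, U i (proj e) -> triv i (act t e) = A t (proj e) *m triv i e.
  exists (fun t _ => local_fibre m n i t); split=> [r c|t e ei].
    exact: local_fibre_regular.
  exact: act_triv.
exists (EquivariantStructure act1 actM act_proj act_linear) => i t e ei /=.
have := local_base_act i t (proj e).
by rewrite act_proj act_triv //; case: (others i).
Qed.

Unset Implicit Arguments.
Set Strict Implicit.

Theorem proposition1p2 (R : realType) (m n : int) (a b : 'I_3 -> R[i]) :
  m != n ->
  (forall i, a i != 0) -> (forall i, b i != 0) ->
  \prod_(i < 3) (a i * b i) = -1 ->
  (forall p : P2 R, U k0 p -> U k1 p -> U k2 p ->
     tau02 m n a b p *m tau21 m n a b p *m tau10 m n a b p = 1%:M) /\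
  inhabited (bundle (tau10 m n a b) (tau21 m n a b) (tau02 m n a b)) /\
  compatible m n k1 k0 (tau10 m n a b) /\
  compatible m n k2 k1 (tau21 m n a b) /\
  compatible m n k0 k2 (tau02 m n a b) /\
  (forall E : bundle (tau10 m n a b) (tau21 m n a b) (tau02 m n a b),
     exists S : equivariant_structure E, extends_local m n S).
Proof.
move=> _ a0 b0 ab.
have cocycle p := @tau_cocycle R m n a b p a0 b0 ab.
have c10 := tau10_compatible m n a b.
have c21 := tau21_compatible m n a b.
have c02 := tau02_compatible m n a b.
split=> //; split; last first.
  by do !split=> //; move=> E; apply: equivariant_extension.
apply: bundle_glue => //.
- exact: tau10_transition.
- exact: tau21_transition.
- exact: tau02_transition.
Qed.
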